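(* Let $R$ and $S$ be commutative rings with identity, $f:R\to S$ a ring homomorphism (preserving identities), and $J$ a non-zero proper ideal of $S$. Consider the properties: (a) $Z(R)^2=0$; (b) for every $r\in \mathrm{Reg}(R)$ and every $j\in J\setminus\{0\}$, $jf(r)\neq 0$; (c) for every $r\in Z(R)\setminus\{0\}$ and every $j\in J\setminus\{0\}$, $jf(r)=0$; (d) $J^2=0$. Suppose that $R\bowtie^f J$ has finitely many elements and that $R\bowtie^f J\not\cong \mathbb{Z}_2\times\mathbb{Z}_2$ as rings. Then the following statements are equivalent: (1) $\Gamma(R\bowtie^f J)$ is complete; (2) properties (a), (b), (c) and (d) hold; (3) $Z(R\bowtie^f J)^2=0$.
   Context: The amalgamation of $R$ with $S$ along $J$ with respect to $f$ is the subring $R\bowtie^f J=\{(r,f(r)+j)\mid r\in R,\ j\in J\}$ of $R\times S$. For a commutative ring $A$, $Z(A)$ is the set of zero-divisors of $A$ (including $0$), and $\mathrm{Reg}(A)=A\setminus Z(A)$ is the set of regular elements; $Z(A)^2=0$ means $xy=0$ for all $x,y\in Z(A)$ (including $x=y$). The zero-divisor graph $\Gamma(A)$ is the undirected graph with vertex set $Z(A)\setminus\{0\}$ in which distinct vertices $x,y$ are adjacent if and only if $xy=0$; it is complete if any two distinct vertices are adjacent. $\mathbb{Z}_2$ denotes $\mathbb{Z}/2\mathbb{Z}$. *)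

(* Defs.v *)
From HB Require Import structures.
From mathcomp Require Import all_boot all_algebra.
From mathcomp Require Import boolp classical_sets cardinality.

Set Implicit Arguments.
Unset Strict Implicit.
Unset Printing Implicit Defensive.

Import GRing.Theory.

Local Open Scope classical_set_scope.
Local Open Scope ring_scope.

(* For a nonzero ring [A] this set contains 0, since 0 * 1 = 0. *)
Definition zero_divisors (A : comPzRingType) : set A :=
  [set x | exists2 y : A, y != 0 & x * y = 0].
Arguments zero_divisors A : clear implicits.

Definition regular_elements (A : comPzRingType) : set A :=
  ~` zero_divisors A.
Arguments regular_elements A : clear implicits.

Definition zero_divisors_sq_eq0 (A : comPzRingType) : Prop :=
  forall x y : A, zero_divisors A x -> zero_divisors A y -> x * y = 0.

Record simple_graph (T : Type) := SimpleGraph {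
  vertices : set T;
  adjacent : T -> T -> Prop;
  adjacent_vertex : forall x y, adjacent x y -> vertices x;
  adjacent_sym : forall x y, adjacent x y -> adjacent y x;
  adjacent_irrefl : forall x, ~ adjacent x x
}.

Definition complete_graph (T : Type) (G : simple_graph T) : Prop :=
  forall x y : T, vertices G x -> vertices G y -> x <> y -> adjacent G x y.

Section ZeroDivisorGraph.
Variable A : comPzRingType.

Definition zdg_vertices : set A := zero_divisors A `\ 0.

Definition zdg_adjacent (x y : A) : Prop :=
  [/\ zdg_vertices x, zdg_vertices y, x <> y & x * y = 0].

Fact zdg_adjacent_vertex x y : zdg_adjacent x y -> zdg_vertices x.
Proof. by case. Qed.

Fact zdg_adjacent_sym x y : zdg_adjacent x y -> zdg_adjacent y x.
Proof.
case=> vx vy xy xy0; split=> //; first by move=> yx; apply: xy.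
by rewrite mulrC.
Qed.

Fact zdg_adjacent_irrefl x : ~ zdg_adjacent x x.
Proof. by case=> _ _ /(_ erefl). Qed.

Definition zero_divisor_graph : simple_graph A :=
  SimpleGraph zdg_adjacent_vertex zdg_adjacent_sym zdg_adjacent_irrefl.

End ZeroDivisorGraph.

Definition ring_isomorphic (A B : pzRingType) : Prop :=
  exists g : {rmorphism A -> B}, bijective g.

(* [idealr S] consists of the proper ideals of [S]: the library includes
   1 \notin J in the structure.  It requires [S] to be nonzero, which is no
   restriction as the zero ring has no proper ideal. *)
Section Amalgamation.
Variables (R : comPzRingType) (S : comNzRingType).
Variables (f : {rmorphism R -> S}) (J : idealr S).

Definition amalgamation_pred : {pred R * S} :=
  fun p => `[< exists r : R, exists2 j : S, j \in J & p = (r, f r + j) >].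

Lemma amalgamation_predE (p : R * S) :
  (p \in amalgamation_pred) = (p.2 - f p.1 \in J).
Proof.
apply/asboolP/idP => [[r [j Jj ->]]|Jp]; first by rewrite /= addrC addKr.
exists p.1, (p.2 - f p.1) => //.
by rewrite addrC subrK -surjective_pairing.
Qed.

Fact amalgamation_subring_closed : subring_closed amalgamation_pred.
Proof.
split=> [|p q|p q]; rewrite !amalgamation_predE /=.
- by rewrite rmorph1 subrr rpred0.
- move=> Jp Jq; have -> : p.2 - q.2 - f (p.1 - q.1)
      = (p.2 - f p.1) - (q.2 - f q.1).
    by rewrite rmorphB !opprB addrACA [- q.2 + _]addrC -[RHS]addrACA.
  exact: rpredB.
- move=> Jp Jq; have -> : p.2 * q.2 - f (p.1 * q.1)
      = p.2 * (q.2 - f q.1) + f q.1 * (p.2 - f p.1).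
    by rewrite rmorphM !mulrBr [f q.1 * p.2]mulrC addrA subrK [f q.1 * _]mulrC.
  by apply: rpredD; apply: idealMr.
Qed.

HB.instance Definition _ :=
  GRing.isSubringClosed.Build (R * S)%type amalgamation_pred
    amalgamation_subring_closed.

Record amalgamation : Type := Amalgamation {
  amalgamation_val :> R * S;
  amalgamation_valP : amalgamation_val \in amalgamation_pred
}.

HB.instance Definition _ := [isSub for amalgamation_val].
HB.instance Definition _ := [Choice of amalgamation by <:].
HB.instance Definition _ :=
  GRing.SubChoice_isSubComPzRing.Build (R * S)%type amalgamation_pred
    amalgamation amalgamation_subring_closed.

End Amalgamation.

(* Main.v *)
Require Import Defs.
From HB Require Import structures.
From mathcomp Require Import all_boot all_algebra.
From mathcomp Require Import boolp classical_sets cardinality.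

(** Write A for the amalgamation and identify R with its copy r |-> (r, f r)
    in A and J with the ideal of the pairs (0, j).

    (1) <-> (3) holds in every commutative ring A which is not Z_2 x Z_2
    (this is a theorem of Anderson and Livingston).  Completeness already says
    that the product of two distinct zero-divisors is 0, so only squares are
    at stake.  If x is a zero-divisor with x ^+ 2 != 0, completeness applied
    to x and x ^+ 2, then to x and x + x ^+ 2, forces x to be idempotent
    ([complete_zdg_idempotent]).  Then A splits as A x * A (1 - x); every
    nonzero element of a factor A e is a zero-divisor, hence is e, as it would
    otherwise kill e ([complete_zdg_corner]).  Both factors are thus Z_2
    ([two_element_corners_iso]).

    (3) -> (2): a zero-divisor of R remains one in A, and every (0, j) is a
    zero-divisor of A because it is not invertible and A is finite
    ([amalgamation_ideal_zero_divisor]).  So (a), (c) and (d) are vanishing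
    products of two zero-divisors of A.  If j * f r = 0 with j != 0, then
    (r, f r) is a zero-divisor, so r ^+ 2 = 0 and r is not regular, which is
    (b).

    (2) -> (3): by (b) and (d), the first component of a zero-divisor of A is
    a zero-divisor of R ([zero_divisor_amalgamation_fst]).  Expanding
    (r, f r + j) * (s, f s + k), the four terms then vanish by (a), (c)
    and (d). *)

Set Implicit Arguments.
Unset Strict Implicit.
Unset Printing Implicit Defensive.

Import GRing.Theory.

Local Open Scope classical_set_scope.
Local Open Scope ring_scope.

(** * Zero-divisors of commutative rings *)

Lemma zero_divisors0 (A : comPzRingType) :
  1 != 0 :> A -> zero_divisors A 0.
Proof. by move=> ne10; exists 1; rewrite ?mul0r. Qed.

(** An injective self-map of a finite set is onto, so multiplication by a
    regular element x reaches 1. *)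
Lemma finite_zero_divisor (A : comPzRingType) (x : A) :
  finite_set [set: A] -> (forall y, x * y != 1) -> zero_divisors A x.
Proof.
move=> /finite_seqP[s sE] xV; apply: contrapT => xreg.
have mems y : y \in s by have : [set: A] y by []; rewrite sE.
have inj : injective ( *%R x).
  move=> y z eq_xyz; apply/eqP; rewrite -subr_eq0; apply/negP => /negP yz.
  by apply: xreg; exists (y - z); rewrite // mulrBr eq_xyz subrr.
have uxs : uniq [seq x * y | y <- undup s] by rewrite map_inj_uniq ?undup_uniq.
have [||_ onto] := uniq_min_size uxs (s2 := undup s).
- by move=> y _; rewrite mem_undup.
- by rewrite size_map.
have := onto 1; rewrite mem_undup mems => /mapP[y _ /esym/eqP].
by rewrite (negPf (xV y)).
Qed.

(** * Idempotents and products of two copies of Z_2 *)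

(** The coordinate of x along e when the ideal A e has only the elements
    0 and e. *)
Definition corner_coord (A : comPzRingType) (e x : A) : 'Z_2 :=
  if x * e == 0 then 0 else 1.

Section TwoElementCorner.
Variables (A : comPzRingType) (e : A).
Hypotheses (e_neq0 : e != 0) (e_idem : e * e = e).
Hypothesis e_corner : forall x, x * e = 0 \/ x * e = e.

Let e_char2 : e + e = 0.
Proof.
have [|] := e_corner (1 + 1); rewrite mulrDl mul1r // => /eqP.
by rewrite -subr_eq0 addrK (negPf e_neq0).
Qed.

Lemma corner_coordE x : e *+ corner_coord e x = x * e.
Proof.
rewrite /corner_coord; case: eqP => [-> | x0]; first by rewrite mulr0n.
by have [|->] := e_corner x.
Qed.

(** Addition and multiplication in A e = {0, e} follow the tables of Z_2. *)
Lemma corner_coord_zmod_morphism : zmod_morphism (corner_coord e).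
Proof.
move=> x y; rewrite /corner_coord mulrBl.
have eN : - e = e by apply/eqP; rewrite eq_sym -addr_eq0 e_char2.
have [-> | ->] := e_corner x; have [-> | ->] := e_corner y;
  by rewrite ?subrr ?subr0 ?sub0r ?eN ?eqxx ?(negPf e_neq0); apply/val_inj.
Qed.

Lemma corner_coord_monoid_morphism : monoid_morphism (corner_coord e).
Proof.
split=> [|x y]; rewrite /corner_coord; first by rewrite mul1r (negPf e_neq0).
rewrite -[in x * y * e]e_idem mulrACA.
have [-> | ->] := e_corner x; have [-> | ->] := e_corner y;
  by rewrite ?mul0r ?mulr0 ?e_idem ?eqxx ?(negPf e_neq0); apply/val_inj.
Qed.

End TwoElementCorner.

(** Peirce decomposition: x = x * e + x * (1 - e) recovers x from its
    coordinates along e and 1 - e. *)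
Lemma two_element_corners_iso (A : comPzRingType) (e : A) :
  e != 0 -> 1 - e != 0 -> e * e = e ->
  (forall x, x * e = 0 \/ x * e = e) ->
  (forall x, x * (1 - e) = 0 \/ x * (1 - e) = 1 - e) ->
  ring_isomorphic A ('Z_2 * 'Z_2)%type.
Proof.
move=> e0 e'0 ee ec e'c.
have ee' : e * (1 - e) = 0 by rewrite mulrBr mulr1 ee subrr.
have e'e' : (1 - e) * (1 - e) = 1 - e.
  by rewrite mulrBl mul1r ee' subr0.
pose g x : 'Z_2 * 'Z_2 := (corner_coord e x, corner_coord (1 - e) x).
have gB : zmod_morphism g.
  by move=> x y; rewrite /g !corner_coord_zmod_morphism.
have gM : monoid_morphism g.
  have [e1 eM] := corner_coord_monoid_morphism e0 ee ec.
  have [e'1 e'M] := corner_coord_monoid_morphism e'0 e'e' e'c.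
  by split=> [|x y]; rewrite /g ?e1 ?e'1 // eM e'M.
pose G : {rmorphism A -> 'Z_2 * 'Z_2} :=
  HB.pack g (GRing.isZmodMorphism.Build _ _ g gB)
            (GRing.isMonoidMorphism.Build _ _ g gM).
exists G; exists (fun p : 'Z_2 * 'Z_2 => e *+ p.1 + (1 - e) *+ p.2) => [x | [a b]] /=.
  by rewrite !corner_coordE // -mulrDr addrC subrK mulr1.
rewrite /g /corner_coord !mulrDl !mulrnAl ee e'e' ee' [(1 - e) * e]mulrC ee'.
rewrite !mul0rn addr0 add0r.
by case: a b => [[|[|a]] la] [[|[|b]] lb] //=;
  rewrite ?mulr0n ?mulr1n ?eqxx ?(negPf e0) ?(negPf e'0); congr pair;
  apply/val_inj.
Qed.

(** * Rings with a complete zero-divisor graph *)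

Section CompleteZeroDivisorGraph.
Variable A : comPzRingType.
Hypothesis A_complete : complete_graph (zero_divisor_graph A).

Let mul0 (x y : A) :
  zero_divisors A x -> zero_divisors A y -> x <> y -> x * y = 0.
Proof.
move=> zx zy xy.
have [-> | x0] := eqVneq x 0; first by rewrite mul0r.
have [-> | y0] := eqVneq y 0; first by rewrite mulr0.
by have [] := @A_complete x y (conj zx (elimN eqP x0)) (conj zy (elimN eqP y0)) xy.
Qed.

(** If x ^+ 2 <> x then x ^+ 3 = 0, so x ^+ 2 kills x + x ^+ 2, which is
    thus a zero-divisor distinct from x; its product with x is x ^+ 2. *)
Lemma complete_zdg_idempotent (x : A) :
  zero_divisors A x -> x * x != 0 -> x * x = x.
Proof.
move=> zx xx0; apply: contrapT => xxx.
have zxx : zero_divisors A (x * x).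
  by have [y y0 xy] := zx; exists y; rewrite // -mulrA xy mulr0.
have x3 : x * (x * x) = 0 by apply: mul0 => // /esym.
have zs : zero_divisors A (x + x * x).
  exists (x * x) => //.
  by rewrite mulrDl x3 -mulrA x3 mulr0 addr0.
have : x * (x + x * x) = 0.
  apply: mul0 => // /eqP; rewrite -subr_eq0 opprD addNKr oppr_eq0.
  by rewrite (negPf xx0).
by rewrite mulrDr x3 addr0; exact/eqP.
Qed.

(** 1 - e kills the whole ideal A e, so an element of A e other than e
    satisfies x * e * e = 0. *)
Lemma complete_zdg_corner (e : A) :
  1 - e != 0 -> e * e = e -> forall x, x * e = 0 \/ x * e = e.
Proof.
move=> e'0 ee x; have [-> | /eqP xe] := eqVneq (x * e) e; [by right | left].
have ee' : e * (1 - e) = 0 by rewrite mulrBr mulr1 ee subrr.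
rewrite -ee mulrA; apply: mul0 xe; exists (1 - e) => //.
by rewrite -mulrA ee' mulr0.
Qed.

Lemma complete_zdg_sq_eq0 :
  ~ ring_isomorphic A ('Z_2 * 'Z_2)%type -> zero_divisors_sq_eq0 A.
Proof.
move=> notZ22 x y zx zy; have [<- | /eqP] := eqVneq x y; last exact: mul0.
apply: contrapT => /eqP xx0; apply: notZ22.
have xx := complete_zdg_idempotent zx xx0.
have x0 : x != 0 by rewrite -xx.
have x'0 : 1 - x != 0.
  have [z z0 xz] := zx; apply: contraNneq z0 => /subr0_eq x1.
  by rewrite -[z]mul1r x1 xz.
apply: (two_element_corners_iso x0 x'0 xx).
  exact: complete_zdg_corner.
apply: complete_zdg_corner; first by rewrite opprB addrC subrK.
by rewrite mulrBl mul1r mulrBr mulr1 xx subrr subr0.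
Qed.

End CompleteZeroDivisorGraph.

Lemma sq_eq0_complete_zdg (A : comPzRingType) :
  zero_divisors_sq_eq0 A -> complete_graph (zero_divisor_graph A).
Proof.
by move=> Z2 x y vx vy xy; split=> //; apply: Z2; [case: vx | case: vy].
Qed.

(** * Zero-divisors of an amalgamation *)

Section AmalgamationZeroDivisors.
Variables (R : comPzRingType) (S : comNzRingType).
Variables (f : {rmorphism R -> S}) (J : idealr S).

Let A := amalgamation f J.

Fact amalgamation_mk_subproof (r : R) (j : S) :
  j \in J -> (r, f r + j) \in amalgamation_pred f J.
Proof. by move=> Jj; rewrite amalgamation_predE /= addrC addKr. Qed.

Definition amalgamation_mk (r : R) (j : S) (Jj : j \in J) : A :=
  Amalgamation (amalgamation_mk_subproof r Jj).

Lemma amalgamationP (x : A) :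
  exists r j (Jj : j \in J), x = amalgamation_mk r Jj.
Proof.
have Jx : (val x).2 - f (val x).1 \in J.
  by rewrite -amalgamation_predE; apply: valP.
exists (val x).1, ((val x).2 - f (val x).1), Jx.
by apply: val_inj; rewrite /= addrC subrK -surjective_pairing.
Qed.

Lemma amalgamation_mk_mul_eq0 (r s : R) (j k : S) (Jj : j \in J) (Jk : k \in J) :
  amalgamation_mk r Jj * amalgamation_mk s Jk = 0 <->
  r * s = 0 /\ (f r + j) * (f s + k) = 0.
Proof.
by split=> [/(congr1 val)[]|[rs jk]] //; apply: val_inj; congr pair.
Qed.

Lemma amalgamation_mk_eq0 (r : R) (j : S) (Jj : j \in J) :
  amalgamation_mk r Jj = 0 <-> r = 0 /\ j = 0.
Proof.
split=> [/(congr1 val)[r0]|[r0 j0]]; last first.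
  by apply: val_inj; rewrite /= r0 j0 rmorph0 addr0.
by rewrite r0 rmorph0 add0r.
Qed.

Lemma amalgamation_source_oner_neq0 : 1 != 0 :> R.
Proof.
by apply/eqP => /(congr1 f)/eqP; rewrite rmorph1 rmorph0 (negPf (oner_neq0 S)).
Qed.

Lemma zero_divisor_amalgamation (r : R) :
  zero_divisors R r -> zero_divisors A (amalgamation_mk r (rpred0 J)).
Proof.
move=> [s s0 rs]; exists (amalgamation_mk s (rpred0 J)).
  by apply: contra_neq s0 => /amalgamation_mk_eq0[].
by apply/amalgamation_mk_mul_eq0; rewrite !addr0 -rmorphM rs rmorph0.
Qed.

(** (0, j) is not invertible because its first component is 0. *)
Lemma amalgamation_ideal_zero_divisor (j : S) (Jj : j \in J) :
  finite_set [set: A] -> zero_divisors A (amalgamation_mk 0 Jj).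
Proof.
move=> finA; apply: finite_zero_divisor => // y; apply/eqP => /(congr1 val)[].
by move=> /esym/eqP; rewrite mul0r (negPf amalgamation_source_oner_neq0).
Qed.

(** If r is regular, an element killing (r, f r + j) has the form (0, k), and
    then k * f r = 0 because k * j = 0. *)
Lemma zero_divisor_amalgamation_fst (r : R) (j : S) (Jj : j \in J) :
  (forall (r : R) (j : S),
     regular_elements R r -> j \in J -> j != 0 -> j * f r != 0) ->
  (forall j k : S, j \in J -> k \in J -> j * k = 0) ->
  zero_divisors A (amalgamation_mk r Jj) -> zero_divisors R r.
Proof.
move=> pb pd [y y0 ry]; apply: contrapT => rreg.
have [s [k [Jk yE]]] := amalgamationP y; rewrite {}yE in y0 ry.
have /amalgamation_mk_mul_eq0[rs eq0] := ry.
have s0 : s = 0.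
  by apply: contrapT => /eqP s0; apply: rreg; exists s.
have k0 : k != 0.
  by apply: contra_neq y0 => k0; apply/amalgamation_mk_eq0.
move: eq0; rewrite s0 rmorph0 add0r mulrDl (pd j) // addr0 mulrC => /eqP.
by rewrite (negPf (pb _ _ rreg Jk k0)).
Qed.

End AmalgamationZeroDivisors.

(** * The equivalences *)

Theorem proposition3p8 (R : comPzRingType) (S : comNzRingType)
    (f : {rmorphism R -> S}) (J : idealr S)
    (J_neq0 : exists2 j : S, j \in J & j != 0)
    (fin_RJ : finite_set [set: amalgamation f J])
    (RJ_not_Z2Z2 :
       ~ ring_isomorphic (amalgamation f J) ('Z_2 * 'Z_2)%type) :
  let prop_a := zero_divisors_sq_eq0 R in
  let prop_b := forall (r : R) (j : S),
    regular_elements R r -> j \in J -> j != 0 -> j * f r != 0 in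
  let prop_c := forall (r : R) (j : S),
    zero_divisors R r -> r != 0 -> j \in J -> j != 0 -> j * f r = 0 in
  let prop_d := forall j k : S, j \in J -> k \in J -> j * k = 0 in
  let stmt1 := complete_graph (zero_divisor_graph (amalgamation f J)) in
  let stmt2 := [/\ prop_a, prop_b, prop_c & prop_d] in
  let stmt3 := zero_divisors_sq_eq0 (amalgamation f J) in
  (stmt1 <-> stmt2) /\ (stmt2 <-> stmt3).
Proof.
move=> prop_a prop_b prop_c prop_d stmt1 stmt2 stmt3.
have h13 : stmt1 -> stmt3 by move=> ?; apply: complete_zdg_sq_eq0.
have h31 : stmt3 -> stmt1 by apply: sq_eq0_complete_zdg.
have h32 : stmt3 -> stmt2.
  move=> Z2; split.
  - move=> r s /(@zero_divisor_amalgamation _ _ f J) zr.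
    move=> /(@zero_divisor_amalgamation _ _ f J) zs.
    by have /amalgamation_mk_mul_eq0[] := Z2 _ _ zr zs.
  - move=> r j rreg Jj j0; apply/eqP => jr; apply: rreg.
    have zr : zero_divisors (amalgamation f J) (amalgamation_mk f r (rpred0 J)).
      exists (amalgamation_mk f 0 Jj).
        by apply: contra_neq j0 => /amalgamation_mk_eq0[].
      apply/amalgamation_mk_mul_eq0.
      by rewrite mulr0 rmorph0 addr0 add0r mulrC.
    have /amalgamation_mk_mul_eq0[rr _] := Z2 _ _ zr zr.
    have [-> | r0] := eqVneq r 0; last by exists r.
    exact/zero_divisors0/(amalgamation_source_oner_neq0 f).
  - move=> r j /(@zero_divisor_amalgamation _ _ f J) zr _ Jj _.
    have zj := amalgamation_ideal_zero_divisor Jj fin_RJ.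
    have /amalgamation_mk_mul_eq0[_] := Z2 _ _ zj zr.
    by rewrite rmorph0 add0r addr0.
  - move=> j k Jj Jk.
    have zj := amalgamation_ideal_zero_divisor Jj fin_RJ.
    have zk := amalgamation_ideal_zero_divisor Jk fin_RJ.
    have /amalgamation_mk_mul_eq0[_] := Z2 _ _ zj zk.
    by rewrite rmorph0 !add0r.
have h23 : stmt2 -> stmt3.
  move=> [pa pb pc pd] x y.
  have [r [j [Jj ->]]] := amalgamationP x.
  have [s [k [Jk ->]]] := amalgamationP y.
  move=> /(zero_divisor_amalgamation_fst pb pd) zr.
  move=> /(zero_divisor_amalgamation_fst pb pd) zs.
  apply/amalgamation_mk_mul_eq0; split; first exact: pa.
  have kill t l : zero_divisors R t -> l \in J -> l * f t = 0.
    move=> zt Jl; have [-> | t0] := eqVneq t 0; first by rewrite rmorph0 mulr0.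
    by have [-> | l0] := eqVneq l 0; [rewrite mul0r | apply: pc].
  rewrite mulrDl !mulrDr -rmorphM (pa _ _ zr zs) rmorph0.
  by rewrite [f r * k]mulrC !kill // pd // !addr0.
split; split; by [move=> /h13/h32 | move=> /h23/h31 | move/h23 | move/h32].
Qed.
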